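(* Let $T\ge 2$ and $\beta<1$, let $\mathbf H_T$ be the mean-field equilibrium operator of the regularized $T$-horizon mean-field game and $A_T$ the associated $(T-1)\times(T-1)$ matrix with spectral radius $\rho(A_T)$, both defined in the context. Let $r\in\mathbb R^{T-1}$ be an entrywise positive vector with $A_T^{\top}r=\rho(A_T)r$ (it exists by Perron--Frobenius), and equip $\{\mu_0\}\times\mathcal P(X)^{T-1}$ with the metric $\|V(\boldsymbol\mu,\tilde{\boldsymbol\mu})\|_r:=\langle r,V(\boldsymbol\mu,\tilde{\boldsymbol\mu})\rangle$, where $V(\boldsymbol\mu,\tilde{\boldsymbol\mu})=(\|\mu_1-\tilde\mu_1\|_{\mathrm{TV}},\dots,\|\mu_{T-1}-\tilde\mu_{T-1}\|_{\mathrm{TV}})$. (i) If $\rho(A_T)<1$, then $\mathbf H_T$ has a unique fixed point in $\{\mu_0\}\times\mathcal P(X)^{T-1}$, and the iterates $\mathbf H_T^k(\boldsymbol\mu)$ converge to it as $k\to\infty$ in this metric, for every starting point $\boldsymbol\mu\in\{\mu_0\}\times\mathcal P(X)^{T-1}$. (ii) If $\rho(A_T)=1$, then for every $\lambda\in(0,1)$ and every starting point, the iterates of $\lambda\mathbf I+(1-\lambda)\mathbf H_T$ converge in this metric to a fixed point of $\mathbf H_T$, where $\mathbf I$ is the identity map.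
   Context: $X$ and $A$ are finite sets; $\mathcal P(\cdot)$ denotes the set of probability measures; $\|\mu-\nu\|_{\mathrm{TV}}=\frac12\sum_{x}|\mu(x)-\nu(x)|$. Fix $\beta\in(0,1)$, $\mu_0\in\mathcal P(X)$, $c:X\times A\times\mathcal P(X)\to\mathbb R$ and $p:X\times A\times\mathcal P(X)\to\mathcal P(X)$ such that, with constants $L_1,K_1>0$, $\beta K_1<2$, for all $x,\hat x,a,\hat a,\mu,\hat\mu$: $|c(x,a,\mu)-c(\hat x,\hat a,\hat\mu)|\le L_1(1_{\{x\ne\hat x\}}+2\cdot1_{\{a\neq\hat a\}}+2\|\mu-\hat\mu\|_{\mathrm{TV}})$ and $\|p(\cdot|x,a,\mu)-p(\cdot|\hat x,\hat a,\hat\mu)\|_{\mathrm{TV}}\le\frac{K_1}{2}(1_{\{x\ne\hat x\}}+2\cdot 1_{\{a\neq\hat a\}}+2\|\mu-\hat\mu\|_{\mathrm{TV}})$. For $u\in\mathcal P(A)$ put $C(x,u,\mu)=\sum_a c(x,a,\mu)u(a)$, $P(\cdot|x,u,\mu)=\sum_a p(\cdot|x,a,\mu)u(a)$. The regularizer $\Omega:\mathcal P(A)\to\mathbb R$ is continuous and $\rho$-strongly convex with respect to $\|\cdot\|_1$, $\rho>0$: $\Omega(su+(1-s)v)\le s\Omega(u)+(1-s)\Omega(v)-\frac{\rho}{2}s(1-s)\|u-v\|_1^2$ for $u,v\in\mathcal P(A)$, $s\in[0,1]$. For a flow $\boldsymbol\mu=(\mu_0,\mu_1,\dots,\mu_{T-1})$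 with the given first entry $\mu_0$, define backwards functions on $X\times\mathcal P(A)$: $Q^{\boldsymbol\mu}_{T-1}(x,u)=C(x,u,\mu_{T-1})+\Omega(u)$ and, for $0\le t\le T-2$, $Q^{\boldsymbol\mu}_t(x,u)=C(x,u,\mu_t)+\Omega(u)+\beta\sum_{y}\min_{b\in\mathcal P(A)}Q^{\boldsymbol\mu}_{t+1}(y,b)P(y|x,u,\mu_t)$. Each $Q_t^{\boldsymbol\mu}(x,\cdot)$ has a unique minimizer $f^{\boldsymbol\mu}_t(x)$. Then $\mathbf H_T(\boldsymbol\mu)=(\mu_0,\hat\mu_1,\dots,\hat\mu_{T-1})$ with $\hat\mu_{t}=\sum_{x}P(\cdot|x,f^{\boldsymbol\mu}_{t-1}(x),\mu_{t-1})\mu_{t-1}(x)$, $1\le t\le T-1$. Fixed points of $\mathbf H_T$ are exactly the state-measure flows of the mean-field equilibria of the regularized $T$-horizon game. The fixed coordinate $\mu_0$ is ignored in $V$. Constants: $\bar L=\frac{L_1}{1-\beta K_1/2}$, $\bar K=\frac{3K_1}{2}+\frac{K_1\bar L}{2\rho(1-\beta)}$. The matrix $A_T=(a_{ij})_{i,j=1}^{T-1}$ is $a_{ij}=\frac{\bar LK_1}{\rho}\beta^{\,j-i+1}$ for $j\ge i$, $a_{i,i-1}=\bar K+\frac{\bar LK_1}{\rho}$, and $a_{ij}=0$ for $j<i-1$. The symbol $\rho$ alone is the strong convexity constant; $\rho(A_T)$ is the spectral radius. *)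

(* Defs.v *)
From HB Require Import structures.
From mathcomp Require Import all_boot all_order all_algebra.
From mathcomp Require Import all_classical all_reals all_analysis.
From mathcomp Require Import complex.

Set Implicit Arguments.
Unset Strict Implicit.
Unset Printing Implicit Defensive.

Import Order.TTheory GRing.Theory Num.Theory.
Import numFieldNormedType.Exports.
Local Open Scope classical_set_scope.
Local Open Scope convex_scope.
Local Open Scope ring_scope.

Definition is_pmf (R : realType) (T : finType) (f : {ffun T -> R}) : bool :=
  [forall x, 0 <= f x] && (\sum_x f x == 1).

Record fprob (R : realType) (T : finType) :=
  FProb { pmf_val :> {ffun T -> R}; _ : is_pmf pmf_val }.

HB.instance Definition _ (R : realType) (T : finType) :=
  [isSub for @pmf_val R T].
HB.instance Definition _ (R : realType) (T : finType) :=
  [Choice of fprob R T by <:].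

(* The Euclidean topology of the simplex, induced from [T -> R]; it is also
   the topology of [l1dist] below. *)
HB.instance Definition _ (R : realType) (T : finType) :=
  Topological.copy (fprob R T)
    (initial_topology (fun m : fprob R T => (m : T -> R) : {ptws T -> R})).

Section FProb.
Context {R : realType}.
Implicit Types S T : finType.

Lemma fprob_ge0 T (m : fprob R T) x : 0 <= m x.
Proof. by case: m => f /= /andP[/forallP]. Qed.

Lemma fprob_sum1 T (m : fprob R T) : \sum_x m x = 1.
Proof. by case: m => f /= /andP[_ /eqP]. Qed.

Lemma fbind_subproof S T (m : fprob R S) (k : S -> fprob R T) :
  is_pmf [ffun y => \sum_x k x y * m x].
Proof.
apply/andP; split.
  apply/forallP => y; rewrite ffunE sumr_ge0// => x _.
  by rewrite mulr_ge0// fprob_ge0.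
under eq_bigr do rewrite ffunE.
rewrite exchange_big/=; under eq_bigr do rewrite -mulr_suml fprob_sum1 mul1r.
by rewrite fprob_sum1.
Qed.

(* The mixture [\sum_x k(. | x) m(x)]. *)
Definition fbind S T (m : fprob R S) (k : S -> fprob R T) : fprob R T :=
  FProb (fbind_subproof m k).

Lemma fconv_subproof T (s : {i01 R}) (u v : fprob R T) :
  is_pmf [ffun x => s%:num * u x + (1 - s%:num) * v x].
Proof.
apply/andP; split.
  apply/forallP => y; by rewrite ffunE addr_ge0// mulr_ge0 ?fprob_ge0//.
under eq_bigr do rewrite ffunE.
by rewrite big_split/= -!mulr_sumr !fprob_sum1 !mulr1 addrC subrK.
Qed.

Definition fconv T (s : {i01 R}) (u v : fprob R T) : fprob R T :=
  FProb (fconv_subproof s u v).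

Section Convex.
Variable T : finType.
Implicit Types (s : {i01 R}) (u v : fprob R T).

Lemma fconv1 u v : fconv 1%:i01 u v = u.
Proof.
by apply/val_inj/ffunP => x; rewrite /= ffunE/= subrr mul0r addr0 mul1r.
Qed.

Lemma fconvmm s u : fconv s u u = u.
Proof.
by apply/val_inj/ffunP => x; rewrite /= ffunE -mulrDl addrC subrK mul1r.
Qed.

Lemma fconvC s u v : fconv s u v = fconv (1 - s%:inum)%:i01 v u.
Proof.
apply/val_inj/ffunP => x; rewrite /= !ffunE/=.
by rewrite [X in _ = _ + X * _]subKr addrC.
Qed.

Lemma fconvA : convex_quasi_associative (@fconv T).
Proof.
move=> p q r s a b c prs spq; apply/val_inj/ffunP => x; rewrite /= !ffunE/=.
have pq := ConvexQuasiAssoc.pq_sr prs spq.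
have spq' : 1 - s%:num = (1 - p%:num) * (1 - q%:num) by exact: spq.
rewrite !mulrDr addrA !mulrA [s%:num * r%:num]mulrC -prs.
by rewrite pq -spq'.
Qed.

HB.instance Definition _ := isConvexSpace.Build R (fprob R T)
  fconv1 fconvmm fconvC fconvA.
End Convex.

Definition l1dist T (u v : fprob R T) : R := \sum_x `|u x - v x|.
Definition tv T (u v : fprob R T) : R := 2^-1 * \sum_x `|u x - v x|.

Definition strongly_convex T (rho : R) (Omega : fprob R T -> R) : Prop :=
  forall (s : {i01 R}) (u v : fprob R T),
    Omega (u <| s |> v) <= s%:num * Omega u + (1 - s%:num) * Omega v
      - rho / 2 * s%:num * (1 - s%:num) * l1dist u v ^+ 2.

(* [u0] is returned only when [g] has no minimizer, which does not happen for
   the continuous functions below. *)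
Definition argmin T (u0 : fprob R T) (g : fprob R T -> R) : fprob R T :=
  xget u0 [set u | forall v, g u <= g v].
Definition minval T (u0 : fprob R T) (g : fprob R T -> R) : R :=
  g (argmin u0 g).

End FProb.

(* The largest modulus of a complex eigenvalue. *)
Definition spectral_radius (R : realType) (n : nat) (M : 'M[R]_n) : R :=
  sup [set Normc.normc z | z in
        [set z : R[i] | eigenvalue (map_mx (real_complex R) M) z]].

(* The horizon is [T = n.+1]: a flow is [(mu_0, ..., mu_n)], and coordinates
   [1, ..., T - 1] of the matrix and of [V] are the ordinals of ['I_n]
   shifted by one. *)
Definition flow (R : realType) (X : finType) (n : nat) : Type :=
  {ffun 'I_n.+1 -> fprob R X}.

Section MeanFieldGame.
Context {R : realType} {X A : finType} {n : nat}.
Variables (beta : R) (c : X -> A -> fprob R X -> R)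
  (p : X -> A -> fprob R X -> fprob R X) (Omega : fprob R A -> R).
Variable u0 : fprob R A.
Implicit Types (mu : flow R X n).

Definition mix_cost (x : X) (u : fprob R A) (m : fprob R X) : R :=
  \sum_a c x a m * u a.

Definition mix_trans (x : X) (u : fprob R A) (m : fprob R X) : fprob R X :=
  fbind u (fun a => p x a m).

(* [Qfun_left mu k] is the function [Q] at time [n - k], with [k] steps left
   before the last decision time [n = T - 1]. *)
Fixpoint Qfun_left mu (k : nat) (x : X) (u : fprob R A) : R :=
  let m := mu (inord (n - k)) in
  mix_cost x u m + Omega u +
  if k is k'.+1 then
    beta * \sum_y minval u0 (Qfun_left mu k' y) * mix_trans x u m y
  else 0.

Definition Qfun mu (t : nat) : X -> fprob R A -> R := Qfun_left mu (n - t).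

Definition best_response mu (t : nat) (x : X) : fprob R A :=
  argmin u0 (Qfun mu t x).

Definition next_measure mu (t : nat) : fprob R X :=
  let m := mu (inord t) in
  fbind m (fun x => mix_trans x (best_response mu t x) m).

(* Only flows whose entry [0] is the prescribed initial measure are of interest,
   so the operator keeps that entry. *)
Definition mfe_operator mu : flow R X n :=
  [ffun t : 'I_n.+1 =>
     if t == ord0 then mu ord0 else next_measure mu (t : nat).-1].

End MeanFieldGame.

Section FlowMetric.
Context {R : realType} {X : finType} {n : nat}.

Definition averaged (lam : {i01 R}) (H : flow R X n -> flow R X n)
    (mu : flow R X n) : flow R X n :=
  [ffun t => mu t <| lam |> H mu t].

Definition flow_diff (mu nu : flow R X n) : 'cV[R]_n :=
  \col_(i < n) tv (mu (lift ord0 i)) (nu (lift ord0 i)).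

Definition flow_dist (r : 'cV[R]_n) (mu nu : flow R X n) : R :=
  \sum_(i < n) r i 0 * flow_diff mu nu i 0.

Definition flow_cvg (r : 'cV[R]_n) (s : nat -> flow R X n) (nu : flow R X n) :
    Prop :=
  flow_dist r (s k) nu @[k --> \oo] --> (0 : R).
End FlowMetric.

Section Constants.
Context {R : realType}.
Variables (beta L1 K1 rho : R).

Definition Lbar : R := L1 / (1 - beta * K1 / 2).

Definition Kbar : R := 3 * K1 / 2 + K1 * Lbar / (2 * rho * (1 - beta)).

Definition mfg_matrix (n : nat) : 'M[R]_n :=
  \matrix_(i < n, j < n)
    if (i <= j)%N then Lbar * K1 / rho * beta ^+ (j - i).+1
    else if i == j.+1 :> nat then Kbar + Lbar * K1 / rho
    else 0.
End Constants.

(* Main.v *)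
(* Let e_t be the total-variation distance of two flows at time t.  Backward
   induction shows that the value functions have oscillation at most Lbar, and
   that the linear part of Q_t moves by at most
   2 Lbar (e_t + beta e_(t+1) + beta^2 e_(t+2) + ...) when the flow changes;
   strong convexity of Omega turns both facts into Lipschitz bounds for the best
   responses, hence V(H mu, H nu) <= A_T V(mu, nu) entrywise.  Pairing with r
   makes the spectral radius s a Lipschitz constant of H in the r-metric.

   The flow space is compact, so the orbit of a nonexpansive map G has a cluster
   point y, and the displacement dist(G^(k+1) y, G^k y) does not depend on k.
   If s < 1 and G = H, a constant displacement must vanish.  If s = 1 and G is
   an average of I and H, it forces equality in the triangle inequality for the
   weighted l1 norm, so the increments of every coordinate of G^k y keep their
   sign; bounded monotone coordinates converge, and the displacement vanishes
   again.  In both cases y is a fixed point, to which the whole orbit converges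
   by nonexpansiveness. *)

Require Import Defs.
From mathcomp Require Import all_boot all_order all_algebra.
From mathcomp Require Import all_classical all_reals all_analysis.
From mathcomp Require Import ring lra zify.

Set Implicit Arguments.
Unset Strict Implicit.
Unset Printing Implicit Defensive.

Import Order.TTheory GRing.Theory Num.Theory.
Import numFieldNormedType.Exports.
Local Open Scope classical_set_scope.
Local Open Scope ring_scope.

(** * Total variation, mixtures and compactness of the simplex *)

Section TotalVariation.
Variable R : realType.
Implicit Types (S T : finType) (B : R).

Lemma tv_ge0 T (u v : fprob R T) : 0 <= tv u v.
Proof. by rewrite mulr_ge0 ?invr_ge0// sumr_ge0. Qed.

Lemma l1dist_tv T (u v : fprob R T) : l1dist u v = 2 * tv u v.
Proof. by rewrite /tv mulrA divff ?mul1r// pnatr_eq0. Qed.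

Lemma tvxx T (u : fprob R T) : tv u u = 0.
Proof. by rewrite /tv big1 ?mulr0// => x _; rewrite subrr normr0. Qed.

Lemma tvC T (u v : fprob R T) : tv u v = tv v u.
Proof. rewrite /tv; congr (_ * _); apply: eq_bigr => x _; exact: distrC. Qed.

Lemma tv_triangle T (v u w : fprob R T) : tv u w <= tv u v + tv v w.
Proof.
rewrite /tv -mulrDr -big_split/= ler_wpM2l ?invr_ge0// ler_sum// => x _.
exact: ler_distD.
Qed.

Lemma tv_eq0 T (u v : fprob R T) : tv u v = 0 -> u = v.
Proof.
move/eqP; rewrite mulf_eq0 invr_eq0 pnatr_eq0/= => /eqP/psumr_eq0P uv.
apply/val_inj/ffunP => x; apply/eqP; rewrite -subr_eq0 -normr_eq0.
by rewrite [X in X == _]uv.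
Qed.

Lemma conv_fprobE T (s : {i01 R}) (u v : fprob R T) x :
  conv s u v x = s%:num * u x + (1 - s%:num) * v x.
Proof. by rewrite /= ffunE. Qed.

Lemma sum_fprob_bound T (u : fprob R T) (g : T -> R) B :
  (forall x, `|g x| <= B) -> `|\sum_x g x * u x| <= B.
Proof.
move=> gB; apply: le_trans (ler_norm_sum _ _ _) _.
rewrite -[leRHS]mulr1 -(fprob_sum1 u) mulr_sumr ler_sum// => x _.
by rewrite normrM (ger0_norm (fprob_ge0 u x)) ler_wpM2r// fprob_ge0.
Qed.

(* Since [u - v] has total mass zero, [g] may be recentred at the midpoint of
   its range. *)
Lemma sum_fprob_diff T (u v : fprob R T) (g : T -> R) B :
  (forall x y, `|g x - g y| <= B) ->
  `|\sum_x g x * u x - \sum_x g x * v x| <= B * tv u v.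
Proof.
move=> gB; rewrite -sumrB.
case: (pickP (@predT T)) => [x0 _|noT]; last first.
  have sum0 (f : T -> R) : \sum_x f x = 0.
    by apply: big_pred0 => x; have := noT x.
  by rewrite /tv !sum0 !mulr0 normr0.
have [y _ ymax] := @arg_maxP _ _ _ x0 predT g erefl.
pose h x := g x - (g y - B / 2).
have hB x : `|h x| <= B / 2.
  have gxy : g x <= g y by exact: ymax.
  have := gB y x; rewrite ger0_norm ?subr_ge0// => gyx.
  by rewrite ler_norml /h; apply/andP; split; lra.
have -> : \sum_x (g x * u x - g x * v x) = \sum_x h x * (u x - v x).
  apply/eqP; rewrite -subr_eq0 -sumrB; apply/eqP.
  rewrite (eq_bigr (fun x => (g y - B / 2) * (u x - v x))); last first.
    by move=> x _; rewrite /h; ring.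
  by rewrite -mulr_sumr sumrB !fprob_sum1 subrr mulr0.
apply: le_trans (ler_norm_sum _ _ _) _.
rewrite /tv mulrA mulr_sumr ler_sum// => x _.
by rewrite normrM ler_wpM2r.
Qed.

Lemma tv_fbindr S T (u : fprob R S) (k k' : S -> fprob R T) B :
  (forall x, tv (k x) (k' x) <= B) -> tv (fbind u k) (fbind u k') <= B.
Proof.
move=> kB; rewrite -[leRHS]mulr1 -(fprob_sum1 u).
apply: (@le_trans _ _ (\sum_x tv (k x) (k' x) * u x)); last first.
  by rewrite mulr_sumr ler_sum// => x _; rewrite ler_wpM2r ?fprob_ge0.
under [leRHS]eq_bigr do rewrite -mulrA.
rewrite -mulr_sumr ler_wpM2l ?invr_ge0//.
under [leRHS]eq_bigr do rewrite mulr_suml.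
rewrite exchange_big/= ler_sum// => y _.
rewrite !ffunE -sumrB; apply: le_trans (ler_norm_sum _ _ _) _.
rewrite ler_sum// => x _.
by rewrite -mulrBl normrM (ger0_norm (fprob_ge0 u x)).
Qed.

(** Testing against the sign of the difference of the two mixtures attains their distance. Moved
    onto the kernel, this test becomes a function [g] on [S] of oscillation at most [B], to which
    [sum_fprob_diff] applies. *)
Lemma tv_fbindl S T (u v : fprob R S) (k : S -> fprob R T) B :
  (forall x y, tv (k x) (k y) <= B) -> tv (fbind u k) (fbind v k) <= B * tv u v.
Proof.
move=> kB.
pose s y := Num.sg (fbind u k y - fbind v k y).
pose g x := 2^-1 * \sum_y s y * k x y.
have sumE (w : fprob R S) : \sum_x g x * w x = 2^-1 * \sum_y s y * fbind w k y.
  under eq_bigr do rewrite -mulrA mulr_suml.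
  rewrite -mulr_sumr exchange_big/=; congr (_ * _).
  apply: eq_bigr => y _; rewrite ffunE mulr_sumr.
  by apply: eq_bigr => x _; rewrite mulrA.
have -> : tv (fbind u k) (fbind v k) = \sum_x g x * u x - \sum_x g x * v x.
  rewrite !sumE -mulrBr -sumrB /tv; congr (_ * _); apply: eq_bigr => y _.
  by rewrite -mulrBr; exact: normrEsg.
apply: le_trans (ler_norm _) _; apply: sum_fprob_diff => x x'.
apply: le_trans (kB x x').
rewrite /g -mulrBr -sumrB normrM ger0_norm ?invr_ge0//.
rewrite /tv ler_wpM2l ?invr_ge0//.
apply: le_trans (ler_norm_sum _ _ _) _; rewrite ler_sum// => y _.
by rewrite -mulrBr normrM normr_sg; case: (_ != 0); rewrite ?mul1r// mul0r.
Qed.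

Lemma fprob_coord_continuous T (x : T) : continuous (fun u : fprob R T => u x).
Proof.
move=> u.
have Hc : continuous (fun m : fprob R T => (m : T -> R) : {ptws T -> R}).
  exact: initial_continuous.
apply: (@continuous_comp _ _ _
  (fun m : fprob R T => (m : T -> R) : {ptws T -> R}) (proj x) u).
  exact: Hc.
exact: proj_continuous.
Qed.

Lemma fprob_compact T : compact [set: fprob R T].
Proof.
pose f (m : fprob R T) : {ptws T -> R} := m.
have KC := @tychonoff T (fun=> R) (fun=> `[0, 1]%classic)
  (fun=> @segment_compact R 0 1).
move=> F FF _.
have [g [/= g01 clg]] :
    [set g : {ptws T -> R} | forall x, `[0, 1]%classic (g x)]
      `&` cluster (f @ F) !=set0.
  apply: KC; apply: (@filterS _ F _ setT) => [m _ x /=|]; last exact: filterT.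
  rewrite in_itv/= fprob_ge0/= -(fprob_sum1 m) (bigD1 x)//= lerDl.
  by rewrite sumr_ge0// => y _; exact: fprob_ge0.
(* Total mass passes to the limit: a filter finer than the image of [F] converges to [g], and the
   sum is 1 along it. *)
have gsum : \sum_x g x = 1.
  move: (clg); rewrite cluster_cvgE => -[G GF [Gg fFG]].
  have : \sum_x (h : {ptws T -> R}) x @[h --> G] --> \sum_x g x.
    apply: cvg_big => [|x _]; first exact: add_continuous.
    by apply: cvg_trans (@proj_continuous _ _ x g); exact: cvg_app.
  move/cvg_unique; apply; first exact: Rhausdorff.
  apply: cvg_near_cst; apply: fFG.
  apply: (@filterS _ F _ setT) => [m _ /=|]; last exact: filterT.
  by rewrite /f fprob_sum1.
have gP : is_pmf [ffun x => g x].
  apply/andP; split.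
    apply/forallP => x; rewrite ffunE.
    by have := g01 x; rewrite in_itv => /andP[].
  by under eq_bigr do rewrite ffunE; rewrite gsum.
have fg : f (FProb gP) = g by apply/funext => x; rewrite /f /= ffunE.
exists (FProb gP); split => // V U FV [_ [[B oB <-] Bg BU]].
have [||h [[m Vm <-] Bm]] := clg (f @` V) B.
- by apply: (@filterS _ F _ V) => // m Vm; exists m.
- by apply: open_nbhs_nbhs; split => //; rewrite -fg.
- by exists m; split => //; exact: BU.
Qed.

Lemma continuous_sum_fprob T (g : T -> R) :
  continuous (fun u : fprob R T => \sum_x g x * u x).
Proof.
move=> u; apply: (cvg_big add_continuous (nbhs_filter u)) => x _.
by apply: cvgM; [exact: cvg_cst|exact: fprob_coord_continuous].
Qed.

Lemma tv_continuous T (v : fprob R T) :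
  continuous (fun u : fprob R T => tv u v).
Proof.
rewrite /tv => u; have FU := @nbhs_filter _ u.
apply: (cvgM (FF := FU)); first exact: (@cvg_cst _ _ _ _ FU).
apply: (cvg_big add_continuous FU) => x _.
apply: (cvg_norm (FF := FU)); apply: (cvgB (FF := FU)).
  exact: fprob_coord_continuous.
exact: (@cvg_cst _ _ _ _ FU).
Qed.

End TotalVariation.

(** * Minimizers of a linear functional plus the regularizer *)

Section RegularizedMinimum.
Variables (R : realType) (A : finType) (rho : R).
Variables (Omega : fprob R A -> R) (u0 : fprob R A).
Hypotheses (rho_gt0 : 0 < rho) (Omega_continuous : continuous Omega).
Hypothesis Omega_strongly_convex : strongly_convex rho Omega.
Implicit Types (g : A -> R) (u v : fprob R A).

Definition regularized g u : R := \sum_a g a * u a + Omega u.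

(** Continuity on the compact simplex yields a minimizer, so [argmin] does not fall back on its
    default [u0]. *)
Lemma argmin_le g v :
  regularized g (argmin u0 (regularized g)) <= regularized g v.
Proof.
suff [u umin] : exists u, forall w, regularized g u <= regularized g w.
  move: v; apply: (@xgetPex _ u0
    [set u | forall w, regularized g u <= regularized g w]).
  by exists u.
have cg : {within setT, continuous (regularized g)}.
  apply/continuous_subspaceT => u; have FU := @nbhs_filter _ u.
  apply: (cvgD (FF := FU)); first exact: continuous_sum_fprob.
  exact: Omega_continuous.
have T0 : [set: fprob R A] !=set0 by exists u0.
have [u _ umin] := compact_EVT_min T0 (@fprob_compact R A) cg.
by exists u => w; apply: umin; rewrite in_setT.
Qed.

(** Moving from the minimizer [u] a fraction [s] of the way towards [v] cannot lower the value;
    strong convexity turns this into [(1 - s) * E <= F], and small [s] gives the claim. *)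
Lemma argmin_growth g v :
  rho / 2 * l1dist (argmin u0 (regularized g)) v ^+ 2 <=
    regularized g v - regularized g (argmin u0 (regularized g)).
Proof.
set u := argmin _ _; set E := rho / 2 * _; set F := regularized g v - _.
have E_ge0 : 0 <= E by rewrite mulr_ge0 ?sqr_ge0// divr_ge0 ?ltW.
have shrink (s : R) : 0 < s -> s < 1 -> (1 - s) * E <= F.
  move=> s0 s1; pose t : {i01 R} := Itv01 (ltW s0) (ltW s1).
  have := argmin_le g (conv t v u).
  have := Omega_strongly_convex t v u; rewrite -/u {2}/regularized.
  have -> : \sum_a g a * conv t v u a
      = s * (\sum_a g a * v a) + (1 - s) * (\sum_a g a * u a).
    rewrite !mulr_sumr -big_split/=; apply: eq_bigr => a _.
    by rewrite ffunE; ring.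
  have -> : l1dist v u = l1dist u v by rewrite !l1dist_tv tvC.
  rewrite /= => scv umin.
  have : s * ((1 - s) * E) <= s * F.
    by rewrite /E /F /regularized in umin *; lra.
  by rewrite ler_pM2l.
rewrite leNgt; apply/negP => FE.
have F_ge : 2^-1 * E <= F.
  by have := shrink 2^-1 ltac:(lra) ltac:(lra); lra.
have E_gt0 : 0 < E by lra.
(* For this [s] the quantity [(1 - s) * E] equals [(E + F) / 2], which exceeds [F]. *)
pose s := (E - F) / (2 * E).
have sE : s * E = (E - F) / 2 by rewrite /s; field; lra.
have s_gt0 : 0 < s by rewrite divr_gt0; lra.
have s_lt1 : s < 1 by rewrite -(ltr_pM2r E_gt0); lra.
have := shrink s s_gt0 s_lt1; lra.
Qed.

Lemma minval_lip g g' (B : R) : (forall a, `|g a - g' a| <= B) ->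
  `|minval u0 (regularized g) - minval u0 (regularized g')| <= B.
Proof.
wlog suff half : g g' / (forall a, `|g a - g' a| <= B) ->
    minval u0 (regularized g) - minval u0 (regularized g') <= B.
  move=> gB; rewrite ler_norml half// andbT lerNl opprB half// => a.
  by rewrite distrC.
move=> gB; rewrite /minval; set u := argmin _ _; set u' := argmin _ _.
have : regularized g u <= regularized g u' by exact: argmin_le.
have : \sum_a (g a - g' a) * u' a <= B.
  by apply: le_trans (ler_norm _) _; exact: sum_fprob_bound.
under eq_bigr do rewrite mulrBl.
rewrite sumrB {2 4}/regularized; lra.
Qed.

(** Each minimizer is tested against the other in [argmin_growth]. On adding, [Omega] cancels and
    leaves [rho * d ^+ 2 <= B * d] for the [l1dist] [d] of the minimizers; as [d] is twice [tv],
    dividing by it produces [2 * rho]. *)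
Lemma argmin_lip g g' (B : R) : (forall a, `|g a - g' a| <= B) ->
  tv (argmin u0 (regularized g)) (argmin u0 (regularized g')) <= B / (2 * rho).
Proof.
move=> gB; set u := argmin _ _; set u' := argmin _ _.
have u_growth : rho / 2 * l1dist u u' ^+ 2 <= _ := argmin_growth g u'.
have u'_growth : rho / 2 * l1dist u' u ^+ 2 <= _ := argmin_growth g' u.
have lC : l1dist u' u = l1dist u u' by rewrite !l1dist_tv tvC.
rewrite lC -/u in u'_growth; rewrite -/u' in u'_growth.
rewrite -/u in u_growth.
have diff : \sum_a (g a - g' a) * (u' a - u a) <= B * l1dist u u'.
  apply: le_trans (ler_norm _) _; apply: le_trans (ler_norm_sum _ _ _) _.
  rewrite mulr_sumr ler_sum// => a _.
  by rewrite normrM (distrC (u' a)) ler_wpM2r.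
have sumE : \sum_a (g a - g' a) * (u' a - u a) =
    (\sum_a g a * u' a - \sum_a g a * u a) -
    (\sum_a g' a * u' a - \sum_a g' a * u a).
  by rewrite -!sumrB; apply: eq_bigr => a _; ring.
have key : rho * l1dist u u' ^+ 2 <= B * l1dist u u'.
  rewrite sumE in diff; rewrite /regularized in u_growth u'_growth; lra.
rewrite l1dist_tv in key; rewrite ler_pdivlMr; last by rewrite mulr_gt0.
(* At distance zero the claim is [0 <= B]; an action witnessing it exists because [u0] has mass
   one. *)
have [->|tv0] := eqVneq (tv u u') 0.
  rewrite mul0r; have [a _|noA] := pickP (@predT A).
    exact: le_trans (normr_ge0 _) (gB a).
  have : \sum_a u0 a = 0 by apply: big_pred0 => a; have := noA a.
  by rewrite fprob_sum1 => /eqP; rewrite oner_eq0.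
have tv_gt0 : 0 < 2 * tv u u' by rewrite mulr_gt0// lt_def tv0 tv_ge0.
by rewrite -(ler_pM2r tv_gt0); move: key; rewrite expr2; lra.
Qed.

End RegularizedMinimum.

Section Sensitivity.
Variables (R : realType) (X A : finType) (n : nat) (beta L1 K1 rho : R).
Variables (c : X -> A -> fprob R X -> R) (p : X -> A -> fprob R X -> fprob R X).
Variables (Omega : fprob R A -> R) (u0 : fprob R A).
Hypotheses (beta_gt0 : 0 < beta) (beta_lt1 : beta < 1).
Hypotheses (L1_gt0 : 0 < L1) (K1_gt0 : 0 < K1) (betaK1 : beta * K1 < 2).
Hypothesis rho_gt0 : 0 < rho.
Hypothesis c_lip : forall x x' a a' m m',
  `|c x a m - c x' a' m'| <=
    L1 * ((x != x')%:R + 2 * (a != a')%:R + 2 * tv m m').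
Hypothesis p_lip : forall x x' a a' m m',
  tv (p x a m) (p x' a' m') <=
    K1 / 2 * ((x != x')%:R + 2 * (a != a')%:R + 2 * tv m m').
Hypothesis Omega_continuous : continuous Omega.
Hypothesis Omega_strongly_convex : strongly_convex rho Omega.
Implicit Types (mu nu : flow R X n) (x y : X) (m : fprob R X) (u : fprob R A).

Local Notation lb := (Lbar beta L1 K1).
Local Notation Q := (Qfun_left beta c p Omega u0).
Local Notation J mu k y := (minval u0 (Q mu k y)).

(** [lb] is the fixed point of the recursion for the oscillation of the value functions: current
    cost plus discounted effect of the transition. *)
Lemma Lbar_rec : L1 + beta * (lb * (K1 / 2)) = lb.
Proof. by have := betaK1; rewrite /Lbar => ?; field; lra. Qed.

Lemma Lbar_gt0 : 0 < lb.
Proof. by have bK := betaK1; rewrite /Lbar divr_gt0//; lra. Qed.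

(** For fixed [x], [Q] is [Omega] plus a functional linear in [u]; these are its coefficients. *)
Definition action_cost mu k x (a : A) : R :=
  let m := mu (inord (n - k)) in
  c x a m + if k is k'.+1 then beta * \sum_y J mu k' y * p x a m y else 0.

Lemma Qfun_leftE mu k x : Q mu k x = regularized Omega (action_cost mu k x).
Proof.
apply/funext => u.
case: k => [|k]; rewrite /regularized /action_cost /= /mix_cost.
  by rewrite addr0; under [in RHS]eq_bigr do rewrite addr0.
rewrite addrAC; congr (_ + _).
under [in RHS]eq_bigr do rewrite mulrDl.
rewrite big_split/=; congr (_ + _).
under [in RHS]eq_bigr do rewrite -mulrA mulr_suml.
rewrite -mulr_sumr exchange_big/=; congr (_ * _).
apply: eq_bigr => y _; rewrite ffunE mulr_sumr.
by apply: eq_bigr => a _; rewrite mulrA.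
Qed.

Definition gap mu nu (t : nat) : R := tv (mu (inord t)) (nu (inord t)).

(** With [t = n - k] and [e] for [gap], this is [e_t + beta e_(t+1) + ... + beta^k e_n] whenever
    [k <= n]. *)
Fixpoint discounted_gap mu nu (k : nat) : R :=
  gap mu nu (n - k) + if k is k'.+1 then beta * discounted_gap mu nu k' else 0.

(** One backward step, with bounds on the next values as hypotheses so that it serves two
    inductions: oscillation ([mu = nu], [D = 0]) and dependence on the flow. The equations
    [k = k'.+1] make these hypotheses vacuous at the last decision time. *)
Lemma action_cost_gap mu nu k x x' a (D : R) : 0 <= D ->
  (forall k', k = k'.+1 -> forall y, `|J mu k' y - J nu k' y| <= D) ->
  (forall k', k = k'.+1 -> forall y y', `|J nu k' y - J nu k' y'| <= lb) ->
  `|action_cost mu k x a - action_cost nu k x' a| <=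
    lb * ((x != x')%:R + 2 * gap mu nu (n - k)) + beta * D.
Proof.
move=> D_ge0 JD Josc; rewrite /action_cost /gap.
set m := mu _; set m' := nu _; set s := _ + 2 * _.
have s_ge0 : 0 <= s by rewrite addr_ge0// mulr_ge0// tv_ge0.
have cs : `|c x a m - c x' a m'| <= L1 * s.
  by have := c_lip x x' a a m m'; rewrite eqxx mulr0 addr0.
rewrite -Lbar_rec.
case: k => [|k] in JD Josc m m' s s_ge0 cs *.
  rewrite !addr0; apply: le_trans cs _; rewrite mulrDl -addrA lerDl.
  apply: addr_ge0; last by rewrite mulr_ge0// ltW.
  rewrite mulr_ge0// mulr_ge0 ?(ltW beta_gt0)// mulr_ge0 ?(ltW Lbar_gt0)//.
  by rewrite divr_ge0// ltW.
rewrite opprD addrACA -mulrBr.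
rewrite [leRHS](_ : _ = L1 * s + beta * (D + lb * (K1 / 2 * s))); last by ring.
apply: le_trans (ler_normD _ _) _; apply: lerD => //.
rewrite normrM gtr0_norm// ler_pM2l//.
(* The value functions are exchanged first, at cost [D], then the transition probabilities, at the
   cost of the oscillation of the values. *)
have -> : \sum_y J mu k y * p x a m y - \sum_y J nu k y * p x' a m' y =
    \sum_y (J mu k y - J nu k y) * p x a m y +
    (\sum_y J nu k y * p x a m y - \sum_y J nu k y * p x' a m' y).
  by under [\sum_y (_ - _) * _]eq_bigr do rewrite mulrBl; rewrite sumrB; ring.
apply: le_trans (ler_normD _ _) _; apply: lerD.
  by apply: sum_fprob_bound; exact: JD.
apply: le_trans (sum_fprob_diff _ _ (Josc _ erefl)) _.
rewrite ler_pM2l ?Lbar_gt0//.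
by have := p_lip x x' a a m m'; rewrite eqxx mulr0 addr0.
Qed.

Lemma action_cost_osc_of_value mu k x x' a :
  (forall k', k = k'.+1 -> forall y y', `|J mu k' y - J mu k' y'| <= lb) ->
  `|action_cost mu k x a - action_cost mu k x' a| <= lb.
Proof.
move=> Josc; have JJ k' : k = k'.+1 -> forall y, `|J mu k' y - J mu k' y| <= 0.
  by move=> _ y; rewrite subrr normr0.
apply: le_trans (@action_cost_gap mu mu k x x' a 0 (lexx 0) JJ Josc) _.
rewrite /gap tvxx !mulr0 !addr0 -[leRHS]mulr1 ler_pM2l ?Lbar_gt0//.
by rewrite lern1 leq_b1.
Qed.

(** The same constant serves at every [k] because the backward step reproduces [lb] from itself, by
    [Lbar_rec]. *)
Lemma value_osc mu k y y' : `|J mu k y - J mu k y'| <= lb.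
Proof.
elim: k y y' => [|k IH] y y'; rewrite !Qfun_leftE;
  apply: (minval_lip u0 Omega_continuous) => a;
  apply: action_cost_osc_of_value => //.
by move=> k' [<-].
Qed.

Lemma action_cost_osc mu k x x' a :
  `|action_cost mu k x a - action_cost mu k x' a| <= lb.
Proof. by apply: action_cost_osc_of_value => k' _ y y'; exact: value_osc. Qed.

Lemma discounted_gap_ge0 mu nu k : 0 <= discounted_gap mu nu k.
Proof.
elim: k => [|k IH] /=; rewrite addr_ge0 ?tv_ge0//.
by rewrite mulr_ge0// ltW.
Qed.

Lemma action_cost_flow_lip mu nu k x a :
  `|action_cost mu k x a - action_cost nu k x a| <=
    2 * lb * discounted_gap mu nu k.
Proof.
elim: k => [|k IH] in x a *.
  apply: le_trans (@action_cost_gap mu nu 0 x x a 0 (lexx 0) _ _) _ => //.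
  by rewrite eqxx mulr0 add0r !addr0 /=; lra.
have D_ge0 : 0 <= 2 * lb * discounted_gap mu nu k.
  by rewrite mulr_ge0 ?discounted_gap_ge0// mulr_ge0// (ltW Lbar_gt0).
apply: le_trans (@action_cost_gap mu nu k.+1 x x a _ D_ge0 _ _) _.
- move=> k' [<-] y; rewrite !Qfun_leftE.
  by apply: (minval_lip u0 Omega_continuous) => b; exact: IH.
- by move=> k' _ y y'; exact: value_osc.
- by rewrite eqxx add0r /=; lra.
Qed.

Local Notation br := (best_response beta c p Omega u0).

Lemma best_responseE mu t x :
  br mu t x = argmin u0 (regularized Omega (action_cost mu (n - t) x)).
Proof. by rewrite /best_response /Qfun Qfun_leftE. Qed.

Lemma best_response_osc mu t x y :
  tv (br mu t x) (br mu t y) <= lb / (2 * rho).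
Proof.
rewrite !best_responseE; apply: argmin_lip => // a; exact: action_cost_osc.
Qed.

Lemma best_response_lip mu nu t x :
  tv (br mu t x) (br nu t x) <= lb / rho * discounted_gap mu nu (n - t).
Proof.
rewrite !best_responseE.
rewrite [leRHS](_ : _ = 2 * lb * discounted_gap mu nu (n - t) / (2 * rho)).
  by apply: argmin_lip => // a; exact: action_cost_flow_lip.
by have := rho_gt0 => ?; field; lra.
Qed.

(** The state and the measure are changed under the same action law, then the law itself;
    transitions at two actions are at most [K1] apart, which is [K1 / 2] times the weight 2 of the
    action term. *)
Lemma mix_trans_lip x x' u u' m m' :
  tv (mix_trans p x u m) (mix_trans p x' u' m') <=
    K1 / 2 * ((x != x')%:R + 2 * tv m m') + K1 * tv u u'.
Proof.
apply: le_trans (tv_triangle (mix_trans p x' u m') _ _) _; apply: lerD.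
  apply: tv_fbindr => a; have := p_lip x x' a a m m'.
  by rewrite eqxx mulr0 addr0.
apply: tv_fbindl => a a'; have := p_lip x' x' a a' m' m'.
rewrite eqxx tvxx add0r mulr0 addr0 => /le_trans; apply.
by have := K1_gt0; case: (a != a') => /=; lra.
Qed.

(** The outer measure changes first, at the cost of the oscillation of the kernel over states; then
    the kernel changes, through its explicit measure argument and through the best response. *)
Lemma next_measure_lip mu nu t :
  tv (next_measure beta c p Omega u0 mu t) (next_measure beta c p Omega u0 nu t)
    <= Kbar beta L1 K1 rho * gap mu nu t
       + lb * K1 / rho * discounted_gap mu nu (n - t).
Proof.
set E := discounted_gap _ _ _; set e := gap _ _ _; rewrite /next_measure.
set m := mu _; set m' := nu _.
have e_ge0 : 0 <= e := tv_ge0 _ _.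
have lb_gt0 := Lbar_gt0.
have step1 : tv (fbind m (fun x => mix_trans p x (br mu t x) m))
    (fbind m' (fun x => mix_trans p x (br mu t x) m))
    <= (K1 / 2 + K1 * (lb / (2 * rho))) * e.
  apply: tv_fbindl => x y; apply: le_trans (mix_trans_lip _ _ _ _ _ _) _.
  rewrite tvxx mulr0 addr0.
  apply: lerD; last by rewrite ler_pM2l// best_response_osc.
  by have := K1_gt0; case: (x != y) => /=; lra.
have step2 : tv (fbind m' (fun x => mix_trans p x (br mu t x) m))
    (fbind m' (fun x => mix_trans p x (br nu t x) m'))
    <= K1 * e + K1 * (lb / rho * E).
  apply: tv_fbindr => x; apply: le_trans (mix_trans_lip _ _ _ _ _ _) _.
  rewrite eqxx add0r; apply: lerD; first by rewrite /e /gap -/m -/m'; lra.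
  by rewrite ler_pM2l// best_response_lip.
apply: le_trans
  (tv_triangle (fbind m' (fun x => mix_trans p x (br mu t x) m)) _ _) _.
apply: le_trans (lerD step1 step2) _.
(* [Kbar] dominates the coefficient of [e] because [1 / (1 - beta) >= 1]. *)
have Kb : K1 / 2 + K1 * (lb / (2 * rho)) + K1 <= Kbar beta L1 K1 rho.
  pose w := K1 * (lb / (2 * rho)).
  have -> : Kbar beta L1 K1 rho = 3 * K1 / 2 + w / (1 - beta).
    by rewrite /Kbar /w invfM !mulrA.
  suff : w <= w / (1 - beta) by rewrite -/w; lra.
  rewrite ler_peMr//; first by rewrite ltW// mulr_gt0// divr_gt0// mulr_gt0.
  by have [b0 b1] := (beta_gt0, beta_lt1); rewrite invf_ge1; lra.
have := ler_wpM2r e_ge0 Kb.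
rewrite (_ : K1 * (lb / rho * E) = lb * K1 / rho * E); last by ring.
lra.
Qed.

End Sensitivity.

(** * From discounted gaps to the matrix and its eigenvector *)

Section MatrixBound.
Variables (R : realType) (X : finType) (n : nat).
Implicit Types (mu nu : flow R X n) (r : 'cV[R]_n) (beta : R).

Lemma gapS mu nu (j : 'I_n) : gap mu nu j.+1 = flow_diff mu nu j 0.
Proof.
rewrite /gap mxE; have -> // : inord j.+1 = lift ord0 j :> 'I_n.+1.
by apply: val_inj; rewrite /= inordK// ltnS ltn_ord.
Qed.

(** Column [j] stands for time [j + 1], hence the successor in the exponent, which counts the steps
    from time [n - k]. *)
Lemma discounted_gapE beta mu nu (k : nat) : (k <= n)%N ->
  discounted_gap beta mu nu k = gap mu nu (n - k) +
    \sum_(j < n | (n - k <= j)%N)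
      beta ^+ (j - (n - k)).+1 * flow_diff mu nu j 0.
Proof.
elim: k => [_|k IH kn] /=.
  by rewrite big_pred0// => j; rewrite subn0 leqNgt ltn_ord.
rewrite IH ?(ltnW kn)//; congr (_ + _).
have nkE : (n - k = (n - k.+1).+1)%N by lia.
have jn : (n - k.+1 < n)%N by lia.
rewrite [RHS](bigD1 (Ordinal jn))//= subnn expr1 {1}nkE.
rewrite (gapS mu nu (Ordinal jn)).
rewrite mulrDr; congr (_ + _); rewrite mulr_sumr; apply: eq_big => j.
  rewrite -val_eqE /= nkE.
  by rewrite ltn_neqAle eq_sym andbC.
rewrite nkE => jk; rewrite mulrA -exprS; congr (_ ^+ _ * _).
by lia.
Qed.

(** Row [i] concerns the image measure at time [i + 1], so the right-hand side is the bound of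
    [next_measure_lip] at time [i]. The gap at time [i] enters both of its terms, hence the sum of
    two constants below the diagonal. *)
Lemma mfg_matrix_mulE (beta L1 K1 rho : R) mu nu (i : 'I_n) :
  mu ord0 = nu ord0 ->
  (mfg_matrix beta L1 K1 rho n *m flow_diff mu nu) i 0 =
  Kbar beta L1 K1 rho * gap mu nu i +
    Lbar beta L1 K1 * K1 / rho * discounted_gap beta mu nu (n - i).
Proof.
move=> mu_nu0; have in_le : (i <= n)%N := ltnW (ltn_ord i).
rewrite discounted_gapE ?leq_subr// subKn//.
set Kb := Kbar _ _ _ _; set C := Lbar _ _ _ * K1 / rho.
rewrite mxE (eq_bigr (fun j : 'I_n =>
    (if (i <= j)%N then C * (beta ^+ (j - i).+1 * flow_diff mu nu j 0) else 0) +
    (if i == j.+1 :> nat then (Kb + C) * flow_diff mu nu j 0 else 0)));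
  last first.
  move=> j _; rewrite mxE -/Kb -/C; case: ifPn => [ij|_].
    rewrite ifF ?addr0 ?mulrA//; apply/negbTE/eqP; lia.
  by case: ifP; rewrite ?add0r ?addr0 ?mul0r.
rewrite big_split/= -!big_mkcond/= -!mulr_sumr.
suff -> : \sum_(j < n | i == j.+1 :> nat) flow_diff mu nu j 0 = gap mu nu i.
  by ring.
(* Row 0 has no subdiagonal entry, and the gap at time 0 vanishes because the flows share their
   initial measure. *)
case iE : (i : nat) => [|i'].
  rewrite big_pred0// /gap; have -> : inord 0 = ord0 :> 'I_n.+1.
    by apply: val_inj; rewrite /= inordK.
  by rewrite mu_nu0 tvxx.
have i'n : (i' < n)%N by rewrite -iE; exact: ltnW.
rewrite (gapS mu nu (Ordinal i'n)) (big_pred1 (Ordinal i'n))//.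
Qed.

(** [r] is a left eigenvector of [B], so pairing with it turns [B] into the scalar [s]; its positive
    weights preserve the entrywise inequality. *)
Lemma flow_dist_mulmx (B : 'M[R]_n) r (s : R) mu nu mu' nu' :
  (forall i, 0 < r i 0) -> B^T *m r = s *: r ->
  (forall i, flow_diff mu' nu' i 0 <= (B *m flow_diff mu nu) i 0) ->
  flow_dist r mu' nu' <= s * flow_dist r mu nu.
Proof.
move=> r_gt0 Br le_diff; rewrite /flow_dist.
apply: (@le_trans _ _ (\sum_i r i 0 * (B *m flow_diff mu nu) i 0)).
  by apply: ler_sum => i _; rewrite ler_pM2l.
under eq_bigr do rewrite mxE mulr_sumr.
rewrite exchange_big/= mulr_sumr ler_sum// => j _.
have /matrixP/(_ j 0) := Br; rewrite !mxE => Brj.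
rewrite mulrA -Brj mulr_suml ler_sum// => i _.
by rewrite mulrA mxE [B i j * _]mulrC.
Qed.

End MatrixBound.

(** * Bounded real sequences whose increments keep their sign *)

Section MonotoneIncrements.
Variable R : realType.
Implicit Types a : nat -> R.

Lemma increment_cvg0_of_pos a (ub : R) M : (forall m, a m <= ub) ->
  (forall m, 0 < a m.+1 - a m -> 0 < a m.+2 - a m.+1) -> 0 < a M.+1 - a M ->
  a m.+1 - a m @[m --> \oo] --> 0.
Proof.
move=> a_ub pos posM; pose u k := a (k + M)%N.
have u_cvg : cvgn u.
  apply: nondecreasing_is_cvgn; last by exists ub => _ [k _ <-]; exact: a_ub.
  apply/nondecreasing_seqP => k; rewrite -subr_ge0 ltW// /u addSn.
  by elim: k => //= k IH; exact: pos.
have a_cvg : a @ \oo --> limn u by rewrite -(cvg_shiftn M).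
rewrite -(subrr (limn u)); apply: cvgB => //.
by rewrite (cvg_shiftS a).
Qed.

(** Either some increment is positive, or some is negative and [- a] falls under the first case, or
    all increments are zero. *)
Lemma increment_cvg0 a (B : R) : (forall m, `|a m| <= B) ->
  (forall m, 0 < a m.+1 - a m -> 0 < a m.+2 - a m.+1) ->
  (forall m, a m.+1 - a m < 0 -> a m.+2 - a m.+1 < 0) ->
  a m.+1 - a m @[m --> \oo] --> 0.
Proof.
move=> aB pos neg.
have [[M posM]|/forallNP nopos] := pselect (exists M, 0 < a M.+1 - a M).
  apply: (increment_cvg0_of_pos _ pos posM) => m.
  by apply: le_trans (aB m); exact: ler_norm.
have [[M negM]|/forallNP noneg] := pselect (exists M, a M.+1 - a M < 0).
  rewrite -oppr0 (_ : (fun m => _) = - (fun m => - a m.+1 - - a m)).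
    apply: cvgN.
    apply: (@increment_cvg0_of_pos (fun m => - a m) B M) => [m|m|].
    - by apply: le_trans (aB m); rewrite -normrN; exact: ler_norm.
    - by move=> h; have := neg m; lra.
    - by lra.
  by apply/funext => m; rewrite fctE; ring.
rewrite (_ : (fun m => _) = fun=> 0); first exact: cvg_cst.
apply/funext => m; apply/eqP; rewrite eq_le !leNgt.
by apply/andP; split; apply/negP; [exact: nopos|exact: noneg].
Qed.

(** If the combination lost the sign of [x], part of [(1 - s) * y] would cancel [s * x] and the
    triangle inequality would be strict. *)
Lemma convex_norm_eq_sign (s x y : R) : 0 < s < 1 ->
  `|s * x + (1 - s) * y| = s * `|x| + (1 - s) * `|y| ->
  (0 < x -> 0 < s * x + (1 - s) * y) /\ (x < 0 -> s * x + (1 - s) * y < 0).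
Proof.
move=> /andP[s_gt0 s_lt1]; set z := _ + _ => zE.
have s'_gt0 : 0 < 1 - s by lra.
have sy_le : (1 - s) * y <= (1 - s) * `|y| by rewrite ler_pM2l// ler_norm.
have sNy_le : - ((1 - s) * y) <= (1 - s) * `|y|.
  by rewrite -mulrN ler_pM2l// -normrN ler_norm.
split=> x0.
  have sx : 0 < s * x by rewrite mulr_gt0.
  rewrite ltNge; apply/negP => z0; move: zE.
  by rewrite (ler0_norm z0) (gtr0_norm x0) => zE; rewrite /z in zE z0; lra.
have sx : s * x < 0 by rewrite pmulr_rlt0.
rewrite ltNge; apply/negP => z0; move: zE.
by rewrite (ger0_norm z0) (ltr0_norm x0) => zE; rewrite /z in zE z0; lra.
Qed.

End MonotoneIncrements.

(** * The weighted metric and nonexpansive maps on flows *)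

Section FlowDynamics.
Variables (R : realType) (X : finType) (n : nat) (r : 'cV[R]_n).
Hypothesis r_gt0 : forall i, 0 < r i 0.
Implicit Types (mu nu : flow R X n) (G H : flow R X n -> flow R X n).

Local Notation dist := (flow_dist r).

Lemma flow_distE mu nu :
  dist mu nu = \sum_(i < n) r i 0 * tv (mu (lift ord0 i)) (nu (lift ord0 i)).
Proof. by apply: eq_bigr => i _; rewrite mxE. Qed.

Lemma flow_dist_ge0 mu nu : 0 <= dist mu nu.
Proof.
by rewrite flow_distE sumr_ge0// => i _; rewrite mulr_ge0 ?tv_ge0// ltW.
Qed.

Lemma flow_distC mu nu : dist mu nu = dist nu mu.
Proof. by rewrite !flow_distE; apply: eq_bigr => i _; rewrite tvC. Qed.

Lemma flow_dist_triangle nu mu xi : dist mu xi <= dist mu nu + dist nu xi.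
Proof.
rewrite !flow_distE -big_split/= ler_sum// => i _.
by rewrite -mulrDr ler_pM2l// tv_triangle.
Qed.

Lemma flow_dist_le0 mu nu : mu ord0 = nu ord0 -> dist mu nu <= 0 -> mu = nu.
Proof.
move=> mu_nu0 d_le0.
have : dist mu nu = 0 by apply/eqP; rewrite eq_le d_le0 flow_dist_ge0.
rewrite flow_distE => /psumr_eq0P d0; apply/ffunP => t.
case: (unliftP ord0 t) => [i ->|->//]; apply: tv_eq0.
have /eqP := d0 (fun i _ => mulr_ge0 (ltW (r_gt0 i)) (tv_ge0 _ _)) i isT.
by rewrite mulf_eq0 gt_eqF// => /eqP.
Qed.

Lemma flow_cluster_point (s : nat -> flow R X n) (m0 : fprob R X) :
  exists2 nu : flow R X n, nu ord0 = m0 &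
    forall (e : R) (N : nat), 0 < e ->
      exists2 k, (N <= k)%N & dist (s k) nu < e.
Proof.
pose E := prod_topology (fun _ : 'I_n.+1 => fprob R X).
pose f k : E := s k.
have EC := @tychonoff _ (fun _ : 'I_n.+1 => fprob R X) _
  (fun=> @fprob_compact R X).
have [|g [_ clg]] := EC (f @ \oo) _; first by exists 0%N.
pose h (z : E) := \sum_(i < n) r i 0 * tv (z (lift ord0 i)) (g (lift ord0 i)).
have h_cvg : h z @[z --> g] --> h g.
  have Fg := @nbhs_filter E g; apply: (cvg_big add_continuous Fg) => i _.
  apply: (cvgM (FF := Fg)); first exact: (@cvg_cst _ _ _ _ Fg).
  apply: (@continuous_comp E (fprob R X) R (proj (lift ord0 i))
    (fun m => tv m (g (lift ord0 i)))); first exact: proj_continuous.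
  exact: tv_continuous.
have hg : h g = 0 by rewrite /h big1// => i _; rewrite tvxx mulr0.
(* [flow_dist] ignores entry 0, so this entry may be set to [m0]. *)
exists [ffun t => if t == ord0 then m0 else g t]; first by rewrite ffunE.
move=> e N e_gt0.
have fN : (f @ \oo) (f @` [set k | (N <= k)%N]).
  by exists N => // k Nk; exists k.
have ge : nbhs (g : E) [set z | h z < e].
  have := h_cvg [set y | y < e]; apply; rewrite hg.
  exact: lt_nbhsl.
have [_ [[k Nk <-] fke]] := clg _ _ fN ge.
exists k => //; move: fke; rewrite /= /h flow_distE; apply: le_lt_trans.
by rewrite ler_sum// => i _; rewrite ffunE/=.
Qed.

Section Nonexpansive.
Variables (m0 : fprob R X) (G : flow R X n -> flow R X n).
Hypothesis G0 : forall mu, mu ord0 = m0 -> G mu ord0 = m0.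
Hypothesis G_nonexp : forall mu nu, mu ord0 = m0 -> nu ord0 = m0 ->
  dist (G mu) (G nu) <= dist mu nu.

Lemma iter_ord0 k mu : mu ord0 = m0 -> iter k G mu ord0 = m0.
Proof. by move=> mu0; elim: k => //= k; exact: G0. Qed.

Lemma iter_nonexp k mu nu : mu ord0 = m0 -> nu ord0 = m0 ->
  dist (iter k G mu) (iter k G nu) <= dist mu nu.
Proof.
move=> mu0 nu0; elim: k => //= k; apply: le_trans.
by apply: G_nonexp; exact: iter_ord0.
Qed.

(* Displacements are nonincreasing along an orbit, while the orbit of [mu]
   returns arbitrarily close to [nu] arbitrarily late. *)
Lemma cluster_displacement mu nu k : mu ord0 = m0 -> nu ord0 = m0 ->
  (forall (e : R) (N : nat), 0 < e ->
    exists2 k, (N <= k)%N & dist (iter k G mu) nu < e) ->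
  dist (iter k.+1 G nu) (iter k G nu) = dist (G nu) nu.
Proof.
move=> mu0 nu0 clu.
have displ_le (xi : flow R X n) j l : xi ord0 = m0 -> (j <= l)%N ->
    dist (iter l.+1 G xi) (iter l G xi) <= dist (iter j.+1 G xi) (iter j G xi).
  move=> xi0 /subnK <-; rewrite -addnS !iterD.
  by apply: iter_nonexp; exact: iter_ord0.
have displ_diff (xi xi' : flow R X n) j : xi ord0 = m0 -> xi' ord0 = m0 ->
    dist (iter j.+1 G xi) (iter j G xi) <=
    dist (iter j.+1 G xi') (iter j G xi') + 2 * dist xi xi'.
  move=> xi0 xi'0.
  apply: le_trans (flow_dist_triangle (iter j.+1 G xi') _ _) _.
  have := flow_dist_triangle (iter j G xi') (iter j.+1 G xi') (iter j G xi).
  have := iter_nonexp j.+1 xi0 xi'0; have := iter_nonexp j xi0 xi'0.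
  rewrite (flow_distC (iter j G xi)); lra.
apply/eqP; rewrite eq_le (displ_le nu 0)//=; apply/ler_addgt0Pr => e e_gt0.
have e4_gt0 : 0 < e / 4 by rewrite divr_gt0.
have [j _ jnu] := clu _ 0%N e4_gt0; have [l jl lnu] := clu _ (k + j)%N e4_gt0.
have lnu0 := iter_ord0 l mu0; have jnu0 := iter_ord0 j mu0.
have := displ_diff nu (iter l G mu) 0%N nu0 lnu0.
have := displ_diff (iter j G mu) nu k jnu0 nu0.
have := displ_le mu _ _ mu0 jl.
rewrite (flow_distC nu) /= !iterD; lra.
Qed.

(** The distance to a fixed point never grows along the orbit, so a single visit within [e] settles
    all later times. *)
Lemma iter_cvg_cluster mu nu : mu ord0 = m0 -> nu ord0 = m0 -> G nu = nu ->
  (forall (e : R) (N : nat), 0 < e ->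
    exists2 k, (N <= k)%N & dist (iter k G mu) nu < e) ->
  flow_cvg r (fun k => iter k G mu) nu.
Proof.
move=> mu0 nu0 Gnu clu; apply/cvgrPdist_lt => e e_gt0.
have [j _ jnu] := clu e 0%N e_gt0.
exists j => // k /= jk; rewrite sub0r normrN ger0_norm ?flow_dist_ge0//.
apply: le_lt_trans jnu; rewrite -(subnK jk) iterD.
have {1}-> : nu = iter (k - j) G nu by elim: (k - j)%N => //= l <-.
by apply: iter_nonexp => //; exact: iter_ord0.
Qed.

(** The hypothesis isolates what differs between the two regimes: why a flow of constant
    displacement is fixed. *)
Lemma nonexp_iter_cvg :
  (forall nu, nu ord0 = m0 ->
    (forall k, dist (iter k.+1 G nu) (iter k G nu) = dist (G nu) nu) ->
    G nu = nu) ->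
  forall mu, mu ord0 = m0 -> exists nu,
    [/\ nu ord0 = m0, G nu = nu & flow_cvg r (fun k => iter k G mu) nu].
Proof.
move=> rigid mu mu0.
have [nu nu0 clu] := flow_cluster_point (fun k => iter k G mu) m0.
have Gnu : G nu = nu by apply: rigid => // k; exact: cluster_displacement clu.
by exists nu; split => //; exact: iter_cvg_cluster.
Qed.

End Nonexpansive.

(** * Averages of the identity and a nonexpansive map *)

Section Averaged.
Variables (m0 : fprob R X) (H : flow R X n -> flow R X n) (lam : {i01 R}).
Hypothesis lam_in01 : 0 < lam%:num < 1.
Hypothesis H0 : forall mu, mu ord0 = m0 -> H mu ord0 = m0.
Hypothesis H_nonexp : forall mu nu, mu ord0 = m0 -> nu ord0 = m0 ->
  dist (H mu) (H nu) <= dist mu nu.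
Local Notation G := (averaged lam H).

Lemma averagedE mu t x :
  G mu t x = lam%:num * mu t x + (1 - lam%:num) * H mu t x.
Proof. by rewrite ffunE conv_fprobE. Qed.

Lemma averaged_ord0 mu : mu ord0 = m0 -> G mu ord0 = m0.
Proof. by move=> mu0; rewrite ffunE H0// mu0 convmm. Qed.

Lemma averaged_fixed mu : G mu = mu -> H mu = mu.
Proof.
move=> Gmu; apply/ffunP => t; apply/val_inj/ffunP => x.
have := averagedE mu t x; rewrite Gmu => mutx.
have /andP[lam_gt0 lam_lt1] := lam_in01.
have lam'_neq0 : 1 - lam%:num != 0 by rewrite subr_eq0 gt_eqF.
by apply: (mulfI lam'_neq0); move: mutx => /=; lra.
Qed.

Lemma averaged_coordB mu nu t x :
  G mu t x - G nu t x =
  lam%:num * (mu t x - nu t x) + (1 - lam%:num) * (H mu t x - H nu t x).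
Proof. by rewrite !averagedE; ring. Qed.

Lemma averaged_coord_le mu nu t x : `|G mu t x - G nu t x| <=
  lam%:num * `|mu t x - nu t x| + (1 - lam%:num) * `|H mu t x - H nu t x|.
Proof.
have /andP[lam_gt0 lam_lt1] := lam_in01; rewrite averaged_coordB.
apply: le_trans (ler_normD _ _) _.
have lam'_gt0 : 0 < 1 - lam%:num by rewrite subr_gt0.
by rewrite !normrM (gtr0_norm lam_gt0) (gtr0_norm lam'_gt0).
Qed.

Lemma averaged_tv_le mu nu t : tv (G mu t) (G nu t) <=
  lam%:num * tv (mu t) (nu t) + (1 - lam%:num) * tv (H mu t) (H nu t).
Proof.
rewrite /tv !(mulrCA _ 2^-1) -mulrDr ler_wpM2l ?invr_ge0//.
rewrite !mulr_sumr -big_split/=.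
by apply: ler_sum => x _; exact: averaged_coord_le.
Qed.

Lemma averaged_dist_le mu nu : dist (G mu) (G nu) <=
  lam%:num * dist mu nu + (1 - lam%:num) * dist (H mu) (H nu).
Proof.
rewrite !flow_distE !mulr_sumr -big_split/=; apply: ler_sum => i _.
rewrite !(mulrCA _ (r i 0)) -mulrDr ler_pM2l//; exact: averaged_tv_le.
Qed.

Lemma averaged_nonexp mu nu : mu ord0 = m0 -> nu ord0 = m0 ->
  dist (G mu) (G nu) <= dist mu nu.
Proof.
move=> mu0 nu0; apply: le_trans (averaged_dist_le mu nu) _.
have /andP[lam_gt0 lam_lt1] := lam_in01.
have : (1 - lam%:num) * dist (H mu) (H nu) <= (1 - lam%:num) * dist mu nu.
  by rewrite ler_pM2l ?subr_gt0// H_nonexp.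
lra.
Qed.

(** The number [lam * dist mu nu + (1 - lam) * dist (H mu) (H nu)] lies between [dist (G mu) (G nu)]
    and [dist mu nu]. Equal ends leave no slack; the slacks of the coordinates are nonnegative and
    enter with positive weights, so each is zero. *)
Lemma averaged_coord_eq mu nu i x : mu ord0 = m0 -> nu ord0 = m0 ->
  dist (G mu) (G nu) = dist mu nu ->
  `|G mu (lift ord0 i) x - G nu (lift ord0 i) x| =
  lam%:num * `|mu (lift ord0 i) x - nu (lift ord0 i) x|
    + (1 - lam%:num) * `|H mu (lift ord0 i) x - H nu (lift ord0 i) x|.
Proof.
move=> mu0 nu0 eq_dist; set t := lift ord0 i.
apply/eqP; rewrite eq_le averaged_coord_le/=.
have /andP[lam_gt0 lam_lt1] := lam_in01.
have Hle : (1 - lam%:num) * dist (H mu) (H nu) <= (1 - lam%:num) * dist mu nu.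
  by rewrite ler_pM2l ?subr_gt0// H_nonexp.
have dist_le0 : lam%:num * dist mu nu + (1 - lam%:num) * dist (H mu) (H nu)
    - dist (G mu) (G nu) <= 0 by lra.
pose D j := lam%:num * tv (mu (lift ord0 j)) (nu (lift ord0 j)) +
  (1 - lam%:num) * tv (H mu (lift ord0 j)) (H nu (lift ord0 j)) -
  tv (G mu (lift ord0 j)) (G nu (lift ord0 j)).
have D_ge0 j : 0 <= D j by rewrite subr_ge0 averaged_tv_le.
have rD_le0 : \sum_(j < n) r j 0 * D j <= 0.
  apply: le_trans dist_le0; rewrite !flow_distE !mulr_sumr -big_split/= -sumrB.
  apply: ler_sum => j _; rewrite /D le_eqVlt; apply/orP; left.
  by apply/eqP; ring.
have Di_le0 : D i <= 0.
  rewrite -(pmulr_rle0 _ (r_gt0 i)); apply: le_trans rD_le0.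
  rewrite (bigD1 i)//= lerDl sumr_ge0// => j _.
  by rewrite mulr_ge0// ltW.
pose C y := lam%:num * `|mu t y - nu t y|
  + (1 - lam%:num) * `|H mu t y - H nu t y| - `|G mu t y - G nu t y|.
have C_ge0 y : 0 <= C y by rewrite subr_ge0 averaged_coord_le.
rewrite -subr_le0 -/(C x).
have : \sum_y C y <= 0.
  rewrite -(pmulr_rle0 _ (_ : 0 < 2^-1)) ?invr_gt0//; apply: le_trans Di_le0.
  rewrite /D /tv -/t /C sumrB big_split/= -!mulr_sumr.
  by rewrite le_eqVlt; apply/orP; left; apply/eqP; ring.
by apply: le_trans; rewrite (bigD1 x)//= lerDl sumr_ge0.
Qed.

Lemma averaged_rigid nu : nu ord0 = m0 ->
  (forall k, dist (iter k.+1 G nu) (iter k G nu) = dist (G nu) nu) -> G nu = nu.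
Proof.
move=> nu0 displ; pose y k := iter k G nu.
have y0 k : y k ord0 = m0 by apply: iter_ord0 => //; exact: averaged_ord0.
have incr_cvg (i : 'I_n) x :
    y m.+1 (lift ord0 i) x - y m (lift ord0 i) x @[m --> \oo] --> 0.
  pose a m := y m (lift ord0 i) x.
  (* Consecutive displacements are equal, so [averaged_coord_eq] applies to [y m.+1] and [y m]; the
     convex combination is then the next increment. *)
  have sgn m := convex_norm_eq_sign lam_in01 (etrans
    (congr1 Num.norm (esym (averaged_coordB (y m.+1) (y m) (lift ord0 i) x)))
    (averaged_coord_eq i x (y0 m.+1) (y0 m)
      (etrans (displ m.+1) (esym (displ m))))).
  apply: (@increment_cvg0 _ a 1) => m.
  - rewrite ger0_norm ?fprob_ge0// -(fprob_sum1 (y m (lift ord0 i))).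
    by rewrite (bigD1 x)//= lerDl sumr_ge0// => z _; exact: fprob_ge0.
  - by move=> /(sgn m).1; rewrite -averaged_coordB.
  - by move=> /(sgn m).2; rewrite -averaged_coordB.
apply: flow_dist_le0; first by rewrite averaged_ord0.
(* The limit of the displacements, left in the form that the limit rules produce; every term is
   zero. *)
pose z := \sum_(i < n) r i 0 * (2^-1 * \sum_(x : X) `|0 : R|).
have d_cvg : dist (y m.+1) (y m) @[m --> \oo] --> z.
  under eq_cvg do rewrite flow_distE /tv.
  apply: cvg_big => [|i _]; first exact: add_continuous.
  apply: cvgM; first exact: cvg_cst.
  apply: cvgM; first exact: cvg_cst.
  apply: cvg_big => [|x _]; first exact: add_continuous.
  by apply: cvg_norm; exact: incr_cvg.
have : dist (G nu) nu = z.
  apply: cvg_unique d_cvg; first exact: Rhausdorff.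
  by apply: cvg_near_cst; apply: nearW => m; rewrite /y displ.
move->; apply: sumr_le0 => i _.
by rewrite big1 ?mulr0// => x _; rewrite normr0.
Qed.

End Averaged.
End FlowDynamics.

Theorem theorem1 (R : realType) (X A : finType) (n : nat)
    (beta L1 K1 rho : R) (mu0 : fprob R X)
    (c : X -> A -> fprob R X -> R) (p : X -> A -> fprob R X -> fprob R X)
    (Omega : fprob R A -> R) (u0 : fprob R A) (r : 'cV[R]_n) :
  (0 < n)%N -> (* T = n.+1 >= 2 *)
  0 < beta < 1 -> 0 < L1 -> 0 < K1 -> beta * K1 < 2 -> 0 < rho ->
  (forall x x' a a' m m',
     `|c x a m - c x' a' m'| <=
       L1 * ((x != x')%:R + 2 * (a != a')%:R + 2 * tv m m')) ->
  (forall x x' a a' m m',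
     tv (p x a m) (p x' a' m') <=
       K1 / 2 * ((x != x')%:R + 2 * (a != a')%:R + 2 * tv m m')) ->
  continuous Omega ->
  strongly_convex rho Omega ->
  let A_T : 'M[R]_n := mfg_matrix beta L1 K1 rho n in
  let H : flow R X n -> flow R X n := mfe_operator beta c p Omega u0 in
  (forall i, 0 < r i 0) ->
  A_T^T *m r = spectral_radius A_T *: r ->
  (spectral_radius A_T < 1 ->
     exists nu : flow R X n,
       [/\ nu ord0 = mu0, H nu = nu,
           (forall nu' : flow R X n, nu' ord0 = mu0 -> H nu' = nu' -> nu' = nu)
         & forall mu : flow R X n, mu ord0 = mu0 ->
             flow_cvg r (fun k => iter k H mu) nu])
  /\
  (spectral_radius A_T = 1 ->
     forall (lam : {i01 R}), 0 < lam%:num < 1 ->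
     forall mu : flow R X n, mu ord0 = mu0 ->
     exists nu : flow R X n,
       [/\ nu ord0 = mu0, H nu = nu
         & flow_cvg r (fun k => iter k (averaged lam H) mu) nu]).
Proof.
move=> _ /andP[beta_gt0 beta_lt1] L1_gt0 K1_gt0 betaK1 rho_gt0 c_lip p_lip.
move=> Omega_cont Omega_sc A_T H r_gt0 A_T_r; set s := spectral_radius A_T.
have H0 (mu : flow R X n) : mu ord0 = mu0 -> H mu ord0 = mu0.
  by move=> muE; rewrite ffunE eqxx.
have H_lip (mu nu : flow R X n) : mu ord0 = mu0 -> nu ord0 = mu0 ->
    flow_dist r (H mu) (H nu) <= s * flow_dist r mu nu.
  move=> muE nuE; apply: flow_dist_mulmx r_gt0 A_T_r _ => i.
  rewrite mfg_matrix_mulE; last by rewrite muE.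
  rewrite mxE !ffunE/=.
  exact: next_measure_lip.
have H_nonexp (mu nu : flow R X n) : s <= 1 -> mu ord0 = mu0 -> nu ord0 = mu0 ->
    flow_dist r (H mu) (H nu) <= flow_dist r mu nu.
  move=> s_le1 muE nuE; apply: le_trans (H_lip _ _ muE nuE) _.
  by rewrite ler_piMl// flow_dist_ge0.
split=> [s_lt1|s_eq1 lam lam01 mu muE].
  have le0 (d : R) : d <= s * d -> d <= 0.
    by rewrite -subr_ge0 -{2}[d]mul1r -mulrBl nmulr_rge0// subr_lt0.
  have cvgH (mu : flow R X n) : mu ord0 = mu0 -> exists nu : flow R X n,
      [/\ nu ord0 = mu0, H nu = nu & flow_cvg r (fun k => iter k H mu) nu].
    apply: nonexp_iter_cvg => // [mu' nu'|nu nuE displ].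
      exact/H_nonexp/ltW.
    (* The displacement at time 1 equals the initial one, [d], but is also at most [s * d]. *)
    apply: (flow_dist_le0 r_gt0); rewrite ?H0 ?nuE//; apply: le0.
    by rewrite -{1}(displ 1%N) H_lip// H0.
  have uniqH (nu nu' : flow R X n) : nu ord0 = mu0 -> nu' ord0 = mu0 ->
      H nu = nu -> H nu' = nu' -> nu' = nu.
    move=> nuE nu'E Hnu Hnu'.
    apply: (flow_dist_le0 r_gt0); first by rewrite nuE.
    by apply: le0; rewrite -{1}Hnu -{1}Hnu' H_lip.
  (* Existence needs one admissible starting flow; the constant flow at [mu0] is one. *)
  have [nu [nuE Hnu _]] := cvgH [ffun=> mu0] (ffunE _ _).
  exists nu; split => // [nu' nu'E Hnu'|mu muE]; first exact: uniqH.
  have [nu' [nu'E Hnu' cvg_nu']] := cvgH mu muE.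
  by rewrite (uniqH nu' nu).
have s_le1 : s <= 1 by rewrite s_eq1.
have [nu [nuE Gnu cvg_nu]] : exists nu : flow R X n,
    [/\ nu ord0 = mu0, averaged lam H nu = nu
    & flow_cvg r (fun k => iter k (averaged lam H) mu) nu].
  apply: nonexp_iter_cvg muE => //.
  - by move=> nu; exact: averaged_ord0.
  - move=> nu nu' nuE nu'E.
    by apply: averaged_nonexp nuE nu'E => // *; exact: H_nonexp.
  - by move=> nu; apply: averaged_rigid => // *; exact: H_nonexp.
by exists nu; split => //; exact: averaged_fixed Gnu.
Qed.
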